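(* Let $b\ge 2$ be an integer. Every base $b$ number (nonnegative integer) can be written as $r$ times (i.e. $r\otimes_b$) a base $b$ dismal product of base $b$ dismal primes, for some $r\in\{0,1,2,\ldots,b-1\}$.
   Context: Nonnegative integers are written in base $b$: $n=n_{k-1}\ldots n_0|_b$ denotes $\sum_i n_ib^i$ with digits $n_i\in\{0,\ldots,b-1\}$. The dismal product of $m=m_{k-1}\ldots m_0|_b$ and $n=n_{l-1}\ldots n_0|_b$ is the number $m\otimes_b n$ whose $i$-th base $b$ digit, $0\le i\le k+l-2$, is $\max\{\min\{m_j,n_{i-j}\}:0\le j\le k-1,\ 0\le i-j\le l-1\}$. This operation is commutative and associative with multiplicative identity $\beta=b-1$; an empty dismal product is allowed and is defined to be $\beta$. A base $b$ dismal prime is a number different from $\beta$ whose only factorization (under $\otimes_b$) is $\beta$ times itself. *)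

(* Defs.v *)
From mathcomp Require Import all_boot.
Set Implicit Arguments.
Unset Strict Implicit.
Unset Printing Implicit Defensive.

(* The base b is meant to satisfy 1 < b throughout. *)

(* [trunc_log b 0 = 0], so that 0 is written with one digit. *)
Definition num_digits (b n : nat) : nat := (trunc_log b n).+1.

Definition digit (b n i : nat) : nat := (n %/ b ^ i) %% b.

(* The i-th digit of the product.
   The condition [j <= i] is needed because [i - j] is truncated. *)
Definition dismal_mul_digit (b m n i : nat) : nat :=
  \max_(j < num_digits b m | (j <= i) && (i - j < num_digits b n))
     minn (digit b m j) (digit b n (i - j)).

Definition dismal_mul (b m n : nat) : nat :=
  \sum_(i < (num_digits b m + num_digits b n).-1) dismal_mul_digit b m n i * b ^ i.

(* The empty product is the multiplicative identity [b.-1]. *)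
Definition dismal_prod (b : nat) (s : seq nat) : nat :=
  \big[dismal_mul b / b.-1]_(p <- s) p.

Definition dismal_prime (b p : nat) : Prop :=
  p <> b.-1 /\
  forall m n : nat, p = dismal_mul b m n ->
    (m = b.-1 /\ n = p) \/ (m = p /\ n = b.-1).

(* Main.v *)
Require Import Defs.
From mathcomp Require Import all_boot.

(** Attach to a number [n] and a threshold [t] the level set
    [{i | t < digit b n i}] of positions.  The numbers [n] are determined by
    their level sets, and since the digits of a dismal product are maxima of
    minima, the level set of a product at [t] is the Minkowski sum of the level
    sets of the factors at [t] ([ltn_digit_dismal_mul]).  So the monoid laws of
    dismal multiplication are those of addition of sets of naturals, the unit
    [b.-1] having the level set [{0}] at every [t < b.-1]; at larger [t] all
    level sets are empty.

    Call [n] saturated when [b.-1] is one of its digits, i.e. when its highest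
    level set is nonempty.  A Minkowski sum is nonempty only if both summands
    are, so the factors of a saturated number are saturated.  The only saturated
    number with one digit is the unit; hence a factorization of a saturated
    number into two nonunits has both factors strictly shorter, because the
    positions of the leading digits (maxima of the level sets at [0]) add up.
    By induction on the length every saturated number is a product of primes
    ([saturated_dismal_prod]).

    Finally an arbitrary [n] with largest digit [r] is [r] times a saturated
    number: raise every digit of [n] that equals [r] to [b.-1], and multiplying
    by [r] truncates it back to [r]. *)

(** * Base b digits *)

Lemma digit0 b n : digit b n 0 = n %% b.
Proof. by rewrite /digit expn0 divn1. Qed.

Lemma digitS b n i : digit b n i.+1 = digit b (n %/ b) i.
Proof. by rewrite /digit expnS divnMA. Qed.

Lemma digit_divn_exp b n d i : digit b (n %/ b ^ d) i = digit b n (d + i).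
Proof. by rewrite /digit expnD divnMA. Qed.

Lemma digit_lt b n i : 1 < b -> digit b n i < b.
Proof. by move=> hb; rewrite ltn_mod; apply: ltnW. Qed.

Lemma digit_le_pred b n i : 1 < b -> digit b n i <= b.-1.
Proof. by move=> hb; rewrite -ltnS prednK ?digit_lt // ltnW. Qed.

Lemma digit_geq b n d i : 1 < b -> n < b ^ d -> d <= i -> digit b n i = 0.
Proof.
move=> hb ltnd ledi; rewrite /digit divn_small ?mod0n //.
by apply: leq_trans ltnd _; rewrite leq_exp2l.
Qed.

Lemma ltn_exp_num_digits b n : 1 < b -> n < b ^ num_digits b n.
Proof. by move=> hb; apply: trunc_log_ltn. Qed.

Lemma digit_small b a i : 1 < b -> a < b -> digit b a i = if i == 0 then a else 0.
Proof.
move=> hb ltab; case: i => [|i]; first by rewrite digit0 modn_small.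
by rewrite (@digit_geq b a 1) ?expn1.
Qed.

Lemma digit_inj b m n : 1 < b -> (forall i, digit b m i = digit b n i) -> m = n.
Proof.
move=> hb; move: {2}(m + n) (leqnn (m + n)) => s.
elim/ltn_ind: s m n => s IHs m n les eqmn.
case: (posnP (m + n)) => [/eqP|mn0].
  by rewrite addn_eq0 => /andP[/eqP-> /eqP->].
have lt_div k : 0 < k -> k %/ b < k by move=> k0; apply: ltn_Pdiv.
rewrite (divn_eq m b) (divn_eq n b) -!digit0 eqmn; congr (_ * _ + _).
apply: (IHs (m %/ b + n %/ b)) => // [|i]; last by rewrite -!digitS.
apply: leq_trans les; case: (posnP m) mn0 => [->|m0 _].
  by rewrite div0n !add0n; apply: lt_div.
by rewrite -addSn leq_add ?lt_div ?leq_div.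
Qed.

Lemma level_inj b m n : 1 < b ->
  (forall t i, t < digit b m i <-> t < digit b n i) -> m = n.
Proof.
move=> hb eqmn; apply: (@digit_inj b) => // i; apply/eqP; rewrite eqn_leq.
by apply/andP; split; rewrite leqNgt; apply/negP => /eqmn; rewrite ltnn.
Qed.

Lemma ltn_exp_digit b n d : 1 < b ->
  (forall i, d <= i -> digit b n i = 0) -> n < b ^ d.
Proof.
move=> hb n0; have: n %/ b ^ d = 0.
  apply: (@digit_inj b) => // i.
  by rewrite digit_divn_exp n0 ?leq_addr // digit_small ?if_same // ltnW.
by move/eqP; rewrite -leqn0 leqNgt divn_gt0 ?expn_gt0 ?(ltnW hb) // -ltnNge.
Qed.

Lemma digit_sum b N (f : nat -> nat) i : 1 < b -> (forall j, f j < b) ->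
  digit b (\sum_(j < N) f j * b ^ j) i = if i < N then f i else 0.
Proof.
move=> hb; elim: N f i => [|N IHN] f i ltfb.
  by rewrite big_ord0 digit_small ?if_same // ltnW.
rewrite big_ord_recl expn0 muln1.
under eq_bigr => j _ do rewrite lift0 expnSr mulnA.
rewrite -big_distrl /= addnC; case: i => [|i].
  by rewrite digit0 modnMDl modn_small.
rewrite digitS divnMDl ?(ltnW hb) // (divn_small (ltfb _)) addn0.
by rewrite (IHN (fun j => f j.+1)).
Qed.

(** * Level sets and the monoid laws *)

Lemma ltn_bigmax (I : finType) (P : pred I) (F : I -> nat) t :
  t < \max_(i | P i) F i <-> exists2 i, P i & t < F i.
Proof.
split=> [|[i Pi ltF]]; last exact: leq_trans ltF (leq_bigmax_cond _ Pi).
case: (boolP [exists i, P i && (t < F i)]) => [/existsP[i /andP[]]|noI].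
  by exists i.
rewrite ltnNge => /negP[]; apply/bigmax_leqP => i Pi; rewrite leqNgt.
by apply: contra noI => ltF; apply/existsP; exists i; rewrite Pi.
Qed.

Lemma dismal_mul_digit_lt b m n i : 1 < b -> dismal_mul_digit b m n i < b.
Proof.
move=> hb; rewrite -[X in _ < X](ltn_predK hb) ltnS.
by apply/bigmax_leqP => j _; rewrite geq_min digit_le_pred.
Qed.

Lemma digit_gt_num_digits b n t i : 1 < b -> t < digit b n i -> i < num_digits b n.
Proof.
move=> hb ltt; rewrite ltnNge; apply/negP => le_i.
by move: ltt; rewrite (@digit_geq _ _ _ _ hb (@ltn_exp_num_digits _ n hb) le_i).
Qed.

(** The level sets of a product are the Minkowski sums of those of the factors:
    a maximum of minima exceeds [t] exactly when both entries of one of the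
    minima do.  A pair of positions where both digits exceed [t] always meets the
    length bounds of the product, as digits beyond the length vanish. *)
Lemma ltn_digit_dismal_mul b m n t i : 1 < b ->
  t < digit b (dismal_mul b m n) i <->
  exists j k, [/\ i = j + k, t < digit b m j & t < digit b n k].
Proof.
move=> hb.
rewrite /dismal_mul digit_sum => [||j]; [|exact: hb|exact: dismal_mul_digit_lt].
split=> [|[j [k [-> ltm ltn]]]].
  case: ifP => // _ /ltn_bigmax[j /andP[leji _]]; rewrite leq_min => /andP[ltm ltn].
  by exists j, (i - j); rewrite subnKC.
have ltj := digit_gt_num_digits _ _ _ _ hb ltm.
have ltk := digit_gt_num_digits _ _ _ _ hb ltn.
have -> : j + k < (num_digits b m + num_digits b n).-1.
  by rewrite -ltnS prednK ?addn_gt0 // -addnS -addSn leq_add.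
apply/ltn_bigmax; exists (Ordinal ltj); rewrite /= addKn ?leq_addr //.
by rewrite leq_min ltm.
Qed.

Lemma dismal_mulC b m n : 1 < b -> dismal_mul b m n = dismal_mul b n m.
Proof.
move=> hb; apply: (@level_inj b) => // t i.
by split=> /(ltn_digit_dismal_mul _ _ _ _ _ hb)[j [k [-> ltj ltk]]];
  apply/ltn_digit_dismal_mul => //; exists k, j; rewrite addnC.
Qed.

Lemma dismal_mulA b m n p : 1 < b ->
  dismal_mul b m (dismal_mul b n p) = dismal_mul b (dismal_mul b m n) p.
Proof.
move=> hb; apply: (@level_inj b) => // t i; split.
  move=> /(ltn_digit_dismal_mul _ _ _ _ _ hb)[j [x [-> ltj]]].
  move=> /(ltn_digit_dismal_mul _ _ _ _ _ hb)[k [l [-> ltk ltl]]].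
  apply/ltn_digit_dismal_mul => //; exists (j + k), l; split; rewrite ?addnA //.
  by apply/ltn_digit_dismal_mul => //; exists j, k.
move=> /(ltn_digit_dismal_mul _ _ _ _ _ hb)[x [l [-> + ltl]]].
move=> /(ltn_digit_dismal_mul _ _ _ _ _ hb)[j [k [-> ltj ltk]]].
apply/ltn_digit_dismal_mul => //; exists j, (k + l); split; rewrite ?addnA //.
by apply/ltn_digit_dismal_mul => //; exists k, l.
Qed.

(** A one-digit number [r] has the level sets [{0}] below [r] and empty ones from
    [r] on, so multiplying by it truncates every digit at [r]. *)
Lemma ltn_digit_dismal_mul_small b r n t i : 1 < b -> r < b ->
  t < digit b (dismal_mul b r n) i <-> t < r /\ t < digit b n i.
Proof.
move=> hb ltrb; split=> [|[ltr ltn]].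
  case/(ltn_digit_dismal_mul _ _ _ _ _ hb) => j [k [->]].
  by rewrite digit_small //; case: eqP => // ->.
by apply/ltn_digit_dismal_mul => //; exists 0, i; rewrite digit_small.
Qed.

Lemma dismal_mul1n b n : 1 < b -> dismal_mul b b.-1 n = n.
Proof.
move=> hb; have ltb : b.-1 < b by rewrite ltn_predL ltnW.
apply: (@level_inj b) => // t i; split.
  by case/(ltn_digit_dismal_mul_small _ _ _ _ _ hb ltb).
move=> ltt; apply/ltn_digit_dismal_mul_small => //.
by split=> //; apply: leq_trans ltt (digit_le_pred _ _ _ hb).
Qed.

Lemma dismal_muln1 b n : 1 < b -> dismal_mul b n b.-1 = n.
Proof. by move=> hb; rewrite dismal_mulC // dismal_mul1n. Qed.

Lemma dismal_prod_cat b s1 s2 : 1 < b ->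
  dismal_prod b (s1 ++ s2) = dismal_mul b (dismal_prod b s1) (dismal_prod b s2).
Proof.
move=> hb; rewrite /dismal_prod; elim: s1 => [|p s IHs] /=.
  by rewrite big_nil dismal_mul1n.
by rewrite !big_cons IHs dismal_mulA.
Qed.

(** * Saturated numbers *)

Definition saturated b n := exists i, digit b n i = b.-1.

(** The threshold [b.-2] turns saturation into a statement on level sets. *)
Lemma digit_eq_pred b n i : 1 < b -> digit b n i = b.-1 <-> b.-2 < digit b n i.
Proof.
move=> hb; have b2 : b.-2.+1 = b.-1 by rewrite prednK // -ltnS (ltn_predK hb).
rewrite b2; split=> [->//|le_b].
by apply/eqP; rewrite eqn_leq digit_le_pred.
Qed.

Lemma saturated_dismal_mul b m n : 1 < b ->
  saturated b (dismal_mul b m n) -> saturated b m /\ saturated b n.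
Proof.
move=> hb [i /(digit_eq_pred _ _ _ hb)].
case/(ltn_digit_dismal_mul _ _ _ _ _ hb) => j [k [_ ltj ltk]].
by split; [exists j | exists k]; apply/digit_eq_pred.
Qed.

Lemma saturated_small b n : 1 < b -> saturated b n -> n < b -> n = b.-1.
Proof.
move=> hb [i ni] ltn; move: ni; rewrite digit_small //; case: eqP => // _ b0.
by case: b b0 hb {ltn} => [|[]].
Qed.

(** A saturated nonunit [m] has a nonzero digit in some position [i > 0], and
    adding [i] to the support of [n] stays within the support of the product:
    so [n] is strictly shorter than the product. *)
Lemma saturated_dismal_mul_ltn b m n d : 1 < b ->
    saturated b m -> m <> b.-1 -> dismal_mul b m n < b ^ d.+1 ->
  n < b ^ d.
Proof.
move=> hb satm m1 ltmn; apply: ltn_exp_digit => // k ledk; apply/eqP.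
rewrite -leqn0 leqNgt; apply/negP => ltk.
apply: m1; apply: saturated_small => //; rewrite -[b in _ < b]expn1.
apply: ltn_exp_digit => // j j0; apply/eqP; rewrite -leqn0 leqNgt.
apply/negP => ltj; have: 0 < digit b (dismal_mul b m n) (j + k).
  by apply/ltn_digit_dismal_mul => //; exists j, k.
by rewrite (@digit_geq _ _ _ _ hb ltmn) // -add1n leq_add.
Qed.

(** Induction on the length.  As the factors of a saturated nonunit into two
    nonunits are bounded, primality is settled by a finite search. *)
Lemma saturated_dismal_prod b n : 1 < b -> saturated b n ->
  exists2 ps, (forall p, p \in ps -> dismal_prime b p) & n = dismal_prod b ps.
Proof.
move=> hb; have := @ltn_exp_num_digits _ n hb; move: (num_digits b n) => d.
elim: d n => [|d IHd] n ltn satn.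
  (* The only number with no digit at all is 0, which is not saturated. *)
  case: satn => i; rewrite (@digit_geq _ _ _ i hb ltn) // => b1.
  by case: b b1 hb {ltn} => [|[]].
have [n1|/eqP n1] := n =P b.-1.
  by exists [::] => //; rewrite /dismal_prod big_nil.
have shorter m k : n = dismal_mul b m k -> m <> b.-1 -> k <> b.-1 ->
    [/\ m < b ^ d, k < b ^ d, saturated b m & saturated b k].
  move=> nmk m1 k1; rewrite nmk in satn ltn.
  have [satm satk] := saturated_dismal_mul _ _ _ hb satn.
  split=> //; last exact: saturated_dismal_mul_ltn ltn.
  by apply: (@saturated_dismal_mul_ltn b k m) => //; rewrite dismal_mulC.
pose nontrivial (m k : 'I_(b ^ d)) :=
  [&& m != b.-1 :> nat, k != b.-1 :> nat & n == dismal_mul b m k].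
case: (boolP [exists m, exists k, nontrivial m k]) => [|irr].
  case/existsP=> m /existsP[k /and3P[/eqP m1 /eqP k1 /eqP nmk]].
  have [ltm ltk satm satk] := shorter m k nmk m1 k1.
  have [ps primes_ps m_ps] := IHd _ ltm satm.
  have [qs primes_qs k_qs] := IHd _ ltk satk.
  exists (ps ++ qs) => [p|]; last by rewrite dismal_prod_cat // -m_ps -k_qs.
  by rewrite mem_cat => /orP[/primes_ps|/primes_qs].
exists [:: n] => [p|]; last first.
  by rewrite /dismal_prod big_cons big_nil dismal_muln1.
rewrite inE => /eqP->; split=> [|m k nmk]; first exact/eqP.
have [m1|m1] := m =P b.-1; first by left; rewrite nmk m1 dismal_mul1n.
have [k1|k1] := k =P b.-1; first by right; rewrite nmk k1 dismal_muln1.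
have [ltm ltk _ _] := shorter m k nmk m1 k1.
case/negP: irr; apply/existsP; exists (Ordinal ltm); apply/existsP.
exists (Ordinal ltk); rewrite /nontrivial /= -nmk eqxx andbT.
by apply/andP; split; apply/eqP.
Qed.

(** Raising the largest digits of [n] to [b.-1] saturates [n]; multiplication by
    the largest digit undoes this, and leaves the smaller digits alone. *)
Lemma dismal_mul_saturated b n : 1 < b ->
  exists r m, [/\ r < b, saturated b m & n = dismal_mul b r m].
Proof.
move=> hb; have ltb : b.-1 < b by rewrite ltn_predL ltnW.
have [|i0 max_i0] := @eq_bigmax 'I_(num_digits b n) (fun i => digit b n i).
  by rewrite card_ord.
set r := digit b n i0 in max_i0.
have ltr : r < b by apply: digit_lt.
have le_r i : digit b n i <= r.
  case: (ltnP i (num_digits b n)) => [lti|lei]; last first.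
    by rewrite (@digit_geq _ _ _ _ hb (@ltn_exp_num_digits _ n hb)).
  by rewrite -max_i0 (leq_bigmax (Ordinal lti)).
pose f i := if digit b n i == r then b.-1 else digit b n i.
pose m := \sum_(i < num_digits b n) f i * b ^ i.
have digit_m i : digit b m i = if i < num_digits b n then f i else 0.
  by apply: digit_sum => // j; rewrite /f; case: ifP => // _; apply: digit_lt.
exists r, m; split=> //.
  by exists i0; rewrite digit_m ltn_ord /f eqxx.
apply: (@level_inj b) => // t i.
split=> [ltt|/(ltn_digit_dismal_mul_small _ _ _ _ _ hb ltr)[lttr]].
  apply/ltn_digit_dismal_mul_small => //; split; first exact: leq_trans (le_r i).
  rewrite digit_m (@digit_gt_num_digits _ _ _ _ hb ltt) /f.
  by case: ifP => // _; apply: leq_trans ltt (digit_le_pred _ _ _ hb).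
by rewrite digit_m; case: ifP => // _; rewrite /f; case: eqP => // ->.
Qed.

Theorem corollary8 (b : nat) (hb : 1 < b) (n : nat) :
  exists (r : nat) (ps : seq nat),
    r < b /\
    (forall p : nat, p \in ps -> dismal_prime b p) /\
    n = dismal_mul b r (dismal_prod b ps).
Proof.
have [r [m [ltr satm ->]]] := dismal_mul_saturated b n hb.
have [ps primes_ps ->] := saturated_dismal_prod b m hb satm.
by exists r, ps.
Qed.
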